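(* Let $X$ be a deeply lci curve, $L$ a line bundle on $X$, and $W\subset H^0(X,L)$ a linear subspace of dimension $m$. For each irreducible component $Z$ of $X$ let $m_Z$ be the dimension of the image $W_Z$ of $W$ in $H^0(Z,L\otimes\mathcal O_Z)$ and let $g_{Z,X}$ be the rank of the restriction map $H^0(X,\omega_X)\to H^0(Z,\omega_X\otimes\mathcal O_Z)$. Then the Koszul cohomology satisfies $$\mathcal K_{t,0}(X,\omega_X,L,W)=0\quad\text{for all integers } t\ge \max_Z\,(g_{Z,X}-m_Z+m),$$ the maximum being over all irreducible components $Z$ of $X$.
   Context: All varieties are complex projective, reduced, pure-dimensional and possibly reducible; a curve is such a variety of dimension 1. A component sum $Z\le X$ is a union of irreducible components of $X$ with reduced structure; its complement is $Z^+:=\overline{X\setminus Z}$. $X$ is called deeply lci if every component sum $Z$ of $X$ is a local complete intersection and, for every component sum $Z$, the scheme-theoretic intersection $Z\cap Z^+$ is a Cartier divisor on $Z$. $\omega_X$ denotes the dualizing sheaf (a line bundle here). Koszul cohomology: for a vector bundle $E$ on $X$, $\mathcal K_{t,0}(X,E,L,W)$ is the cohomology at the middle term of the Koszul complex $$\bigwedge^{t+1}W\otimes H^0(E\otimes L^{-1})\to\bigwedge^{t}W\otimes H^0(E)\to\bigwedge^{t-1}W\otimes H^0(E\otimes L).$$ *)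

(* Defs.v *)
From HB Require Import structures.
From mathcomp Require Import all_boot all_order all_algebra.
From mathcomp Require Import mathcomp_extra boolp classical_sets functions.
From mathcomp Require Import reals complex mpoly.

Set Implicit Arguments.
Unset Strict Implicit.
Unset Printing Implicit Defensive.

Import Order.TTheory GRing.Theory Num.Theory.

Local Open Scope classical_set_scope.
Local Open Scope ring_scope.

(* All varieties are reduced and projective over an algebraically closed field,
   so a variety is a Zariski closed subset of P^n(K) together with its sheaf of
   regular functions, and a subvariety is a smaller closed subset. *)

(* A point of P^n is represented by its unique homogeneous coordinate vector
   whose first nonzero coordinate is 1.  Vanishing of a homogeneous polynomial
   and quotients of homogeneous polynomials of equal degree do not depend on
   this choice of representative. *)
Definition normalized (K : fieldType) (n : nat) (v : 'rV[K]_n.+1) : bool :=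
  [exists i, (v 0 i == 1) && [forall j : 'I_n.+1, (j < i)%N ==> (v 0 j == 0)]].

Definition pspace (K : fieldType) (n : nat) : Type :=
  {v : 'rV[K]_n.+1 | normalized v}.

Notation fn K n := (pspace K n -> K^o).

Section Zariski.
Context {K : fieldType} {n : nat}.
Local Notation PP := (pspace K n).
Implicit Types (X Y Z U V A C : set PP) (p q : PP) (f g h : fn K n).

Definition peval (a : {mpoly K[n.+1]}) (p : PP) : K := a.@[fun i => val p 0 i].

Definition zclosed A : Prop :=
  exists2 S : set {mpoly K[n.+1]},
    (forall a, S a -> exists d, a \is d.-homog) &
    A = [set p | forall a, S a -> peval a p = 0].

Definition zopen_in X U : Prop := exists2 C, zclosed C & U = X `\` C.

Definition zclosure A : set PP :=
  [set p | forall C, zclosed C -> A `<=` C -> C p].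

Definition zirreducible A : Prop :=
  A !=set0 /\
  forall B C, zclosed B -> zclosed C -> A `<=` B `|` C -> A `<=` B \/ A `<=` C.

Definition component X Z : Prop :=
  [/\ zclosed Z, zirreducible Z, Z `<=` X &
      forall A, zclosed A -> zirreducible A -> Z `<=` A -> A `<=` X -> A = Z].

Definition has_chain A (d : nat) : Prop :=
  exists c : nat -> set PP,
    (forall i, (i <= d)%N -> [/\ zclosed (c i), zirreducible (c i) & c i `<=` A])
    /\ (forall i, (i < d)%N -> c i `<` c i.+1).

Definition krull_dim A (d : nat) : Prop := has_chain A d /\ ~ has_chain A d.+1.

Definition component_sum X Z : Prop :=
  exists2 D : set (set PP), D `<=` component X & Z = \bigcup_(C in D) C.

Definition complementary X Z : set PP := zclosure (X `\` Z).

Definition is_curve X : Prop :=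
  [/\ zclosed X, X !=set0 & forall Z, component X Z -> krull_dim Z 1].

(* f is regular on the (locally closed) set U; the values of f off U are
   irrelevant. *)
Definition regular U f : Prop :=
  forall p, U p -> exists2 V, zopen_in setT V /\ V p &
    exists d (a b : {mpoly K[n.+1]}), [/\ a \is d.-homog, b \is d.-homog &
      forall q, V q -> U q -> peval b q != 0 /\ f q = peval a q / peval b q].

Lemma zclosed0 : zclosed set0.
Proof.
exists [set 1] => [a ->|]; first by exists 0%N; exact: dhomog1.
apply/seteqP; split => // p /= /(_ 1 erefl) /eqP.
by rewrite /peval rmorph1 oner_eq0.
Qed.

Lemma zclosedU A C : zclosed A -> zclosed C -> zclosed (A `|` C).
Proof.
move=> [S hS ->] [T hT ->].
exists [set c | exists2 a, S a & exists2 b, T b & c = a * b] => [c|].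
  move=> [a /hS[d ha]] [b /hT[e hb]] ->; exists (d + e)%N; exact: dhomogM.
apply/seteqP; split => p /=.
  move=> [] h c [a Sa] [b Tb] ->; rewrite /peval mevalM.
    by have := h a Sa; rewrite /peval => ->; rewrite mul0r.
  by have := h b Tb; rewrite /peval => ->; rewrite mulr0.
move=> h; apply: contrapT => /not_orP[] /existsNP[a] /not_implyP[Sa a0].
move=> /existsNP[b] /not_implyP[Tb b0].
have : peval (a * b) p = 0 by apply: h; exists a => //; exists b.
rewrite /peval mevalM => /eqP; rewrite mulf_eq0 => /orP[]/eqP //.
Qed.

Lemma zopen_inT X : zopen_in X X.
Proof. by exists set0; [exact: zclosed0 | rewrite setD0]. Qed.

Lemma zopen_inI X U V : zopen_in X U -> zopen_in X V -> zopen_in X (U `&` V).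
Proof.
move=> [A cA ->] [C cC ->]; exists (A `|` C); first exact: zclosedU.
by rewrite setDUr.
Qed.

Lemma zopen_in_sub X U : zopen_in X U -> U `<=` X.
Proof. by move=> [C _ ->] p []. Qed.

(* an open subset of X is cut out on X by an open subset of P^n *)
Lemma zopen_in_trace X U : zopen_in X U ->
  exists2 V, zopen_in setT V & U = X `&` V.
Proof.
move=> [C cC ->]; exists (~` C); last by rewrite setDE.
by exists C => //; rewrite setTD.
Qed.

Lemma zopen_in_restr X Z U : Z `<=` X -> zopen_in X U -> zopen_in Z (U `&` Z).
Proof.
move=> ZX [C cC ->]; exists C => //; apply/seteqP; split => p /=.
  by move=> [[]].
by move=> [Zp Cp]; split => //; split => //; exact: ZX.
Qed.

Lemma regular_sub U V f : V `<=` U -> regular U f -> regular V f.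
Proof.
move=> VU rf p /VU/rf[N oN [d [a [b [ha hb hab]]]]].
by exists N => //; exists d, a, b; split => // q Nq /VU; exact: hab.
Qed.

Lemma regular_ext U f g : (forall p, U p -> f p = g p) -> regular U f ->
  regular U g.
Proof.
move=> fg rf p /rf[N oN [d [a [b [ha hb hab]]]]].
exists N => //; exists d, a, b; split => // q Nq Uq.
by rewrite -fg //; exact: hab.
Qed.

Lemma regular_cst U (k : K) : regular U (fun=> k).
Proof.
move=> p Up; exists setT; first by split => //; exact: zopen_inT.
exists 0%N, (k *: 1), 1; split; rewrite ?dhomog1 ?rpredZ ?dhomog1 // => q _ _.
by rewrite /peval mevalZ !rmorph1 mulr1 divr1 oner_eq0.
Qed.

Lemma regular_op2 (op : K -> K -> K) U f g :
  (forall d e (a b a' b' : {mpoly K[n.+1]}),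
     a \is d.-homog -> b \is d.-homog -> a' \is e.-homog -> b' \is e.-homog ->
     exists k (A B : {mpoly K[n.+1]}), [/\ A \is k.-homog, B \is k.-homog &
       forall q, peval b q != 0 -> peval b' q != 0 -> peval B q != 0 /\
       op (peval a q / peval b q) (peval a' q / peval b' q)
         = peval A q / peval B q]) ->
  regular U f -> regular U g -> regular U (fun p => op (f p) (g p)).
Proof.
move=> hop rf rg p Up.
have [N [oN Np] [d [a [b [ha hb hab]]]]] := rf p Up.
have [N' [oN' N'p] [e [a' [b' [ha' hb' hab']]]]] := rg p Up.
exists (N `&` N'); first by split => //; exact: zopen_inI.
have [k [A [B [hA hB hAB]]]] := hop _ _ _ _ _ _ ha hb ha' hb'.
exists k, A, B; split => // q [Nq N'q] Uq.
have [b0 ->] := hab q Nq Uq; have [b'0 ->] := hab' q N'q Uq.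
exact: hAB.
Qed.

Lemma regularB U f g : regular U f -> regular U g ->
  regular U (fun p => f p - g p).
Proof.
apply: (@regular_op2 (fun x y => x - y)) => d e a b a' b' ha hb ha' hb'.
exists (d + e)%N, (a * b' - a' * b), (b * b'); split.
- by rewrite rpredB //; [exact: dhomogM | rewrite addnC; exact: dhomogM].
- exact: dhomogM.
move=> q b0 b'0; rewrite /peval mevalB !mevalM mulf_neq0 //; split => //.
by rewrite -mulNr addf_div // mulNr.
Qed.

Lemma regularM U f g : regular U f -> regular U g ->
  regular U (fun p => f p * g p).
Proof.
apply: (@regular_op2 (fun x y => x * y)) => d e a b a' b' ha hb ha' hb'.
exists (d + e)%N, (a * a'), (b * b'); split; try exact: dhomogM.
move=> q b0 b'0; rewrite /peval !mevalM mulf_neq0 //; split => //.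
by rewrite mulf_div.
Qed.

Lemma regularV U f : (forall p, U p -> f p != 0) -> regular U f ->
  regular U (fun p => (f p : K)^-1).
Proof.
move=> f0 rf p /rf[N oN [d [a [b [ha hb hab]]]]].
exists N => //; exists d, b, a; split => // q Nq Uq.
have [b0 fE] := hab q Nq Uq; have := f0 q Uq; rewrite fE => h.
by split; [apply: contraNneq h => ->; rewrite mul0r | rewrite invf_div].
Qed.

Lemma regularXn U f (k : nat) : regular U f ->
  regular U (fun p => (f p : K) ^+ k).
Proof.
move=> rf; elim: k => [|k IH]; first exact: (@regular_cst _ 1).
apply: regular_ext (regularM rf IH) => p _; by rewrite exprS.
Qed.

Lemma regularXz U f (k : int) : (forall p, U p -> f p != 0) -> regular U f ->
  regular U (fun p => (f p : K) ^ k).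
Proof.
case: k => k f0 rf; first exact: regularXn.
apply: regularV; last exact: regularXn.
by move=> p Up; rewrite expf_neq0 // f0.
Qed.

(* O(U): functions regular on U, extended by 0 off U so that equality of
   elements is equality on U.  The unit is therefore the indicator of U. *)
Definition regpred U : {pred fn K n} :=
  fun f => `[< regular U f /\ forall p, ~ U p -> f p = 0 >].

Lemma regpred_zmod U : zmod_closed (regpred U).
Proof.
split=> [|f g]; first by apply/asboolP; split=> // ; exact: (@regular_cst U 0).
move=> /asboolP[rf f0] /asboolP[rg g0]; apply/asboolP; split.
  exact: regularB.
by move=> p Up; rewrite !fctE f0 // g0 // subr0.
Qed.

HB.instance Definition _ U :=
  GRing.isZmodClosed.Build (fn K n) (regpred U) (regpred_zmod U).

Record O U := MkO { oval :> fn K n; ovalP : oval \in regpred U }.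

HB.instance Definition _ U := [isSub for @oval U].
HB.instance Definition _ U := [Choice of O U by <:].
HB.instance Definition _ U := [SubChoice_isSubZmodule of O U by <:].

Definition cutoff U f : fn K n := fun p => if `[< U p >] then f p else 0.

Lemma cutoff_in U f p : U p -> cutoff U f p = f p.
Proof. by move=> Up; rewrite /cutoff asboolT. Qed.

Lemma cutoff_out U f p : ~ U p -> cutoff U f p = 0.
Proof. by move=> Up; rewrite /cutoff asboolF. Qed.

Lemma cutoffP U f : regular U f -> cutoff U f \in regpred U.
Proof.
move=> rf; apply/asboolP; split; last by move=> p; exact: cutoff_out.
by apply: regular_ext rf => p Up; rewrite cutoff_in.
Qed.

Lemma regpredM U f g : f \in regpred U -> g \in regpred U ->
  (fun p => f p * g p : K^o) \in regpred U.
Proof.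
move=> /asboolP[rf f0] /asboolP[rg g0]; apply/asboolP; split.
  exact: regularM.
by move=> p Up; rewrite f0 // mul0r.
Qed.

Definition Ocst U (k : K) : O U := MkO (cutoffP (@regular_cst U k)).
Definition Omul U (a b : O U) : O U := MkO (regpredM (ovalP a) (ovalP b)).

Lemma O_ext U (a b : O U) : (forall p, U p -> a p = b p) -> a = b.
Proof.
move=> ab; apply/val_inj/funext => p /=; have [/ab //|Up] := pselect (U p).
have /asboolP[_ a0] := ovalP a; have /asboolP[_ b0] := ovalP b.
by rewrite a0 // b0.
Qed.

Lemma OmulA U : associative (@Omul U).
Proof. by move=> a b c; apply: O_ext => p _; rewrite /= mulrA. Qed.
Lemma OmulC U : commutative (@Omul U).
Proof. by move=> a b; apply: O_ext => p _; rewrite /= mulrC. Qed.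
Lemma Omul1 U : left_id (Ocst U 1) (@Omul U).
Proof. by move=> a; apply: O_ext => p Up; rewrite /= cutoff_in // mul1r. Qed.
Lemma OmulD U : left_distributive (@Omul U) +%R.
Proof. by move=> a b c; apply: O_ext => p _; rewrite /= !fctE mulrDl. Qed.

HB.instance Definition _ U := GRing.Zmodule_isComPzRing.Build (O U)
  (@OmulA U) (@OmulC U) (@Omul1 U) (@OmulD U).

End Zariski.

(* Sections and restriction maps are given on all subsets, but only their
   values on open subsets of X are meaningful. *)
Record omodule (K : fieldType) (n : nat) (X : set (pspace K n)) := OModule {
  sec : forall U : set (pspace K n), lmodType (O U);
  res : forall U V : set (pspace K n), sec U -> sec V;
  res_id : forall U (s : sec U), zopen_in X U -> res U s = s;
  res_comp : forall U V W (s : sec U),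
    zopen_in X U -> zopen_in X V -> zopen_in X W -> V `<=` U -> W `<=` V ->
    res W (res V s) = res W s;
  resD : forall U V (s t : sec U), zopen_in X U -> zopen_in X V -> V `<=` U ->
    res V (s + t) = res V s + res V t;
  resZ : forall U V (a : O U) (b : O V) (s : sec U),
    zopen_in X U -> zopen_in X V -> V `<=` U ->
    (forall p, V p -> a p = b p) -> res V (a *: s) = b *: res V s;
  sec_separated : forall (A : Type) (U : A -> set (pspace K n)) V (s t : sec V),
    zopen_in X V -> (forall a, zopen_in X (U a)) -> V = \bigcup_a U a ->
    (forall a, res (U a) s = res (U a) t) -> s = t;
  sec_glue : forall (A : Type) (U : A -> set (pspace K n)) V
      (s : forall a, sec (U a)),
    zopen_in X V -> (forall a, zopen_in X (U a)) -> V = \bigcup_a U a ->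
    (forall a b, res (U a `&` U b) (s a) = res (U a `&` U b) (s b)) ->
    exists t : sec V, forall a, res (U a) t = s a
}.

Section Modules.
Context {K : fieldType} {n : nat} {X : set (pspace K n)}.
Local Notation PP := (pspace K n).
Implicit Types (F G : omodule X) (U V N : set PP).

Definition is_hom F G (phi : forall U, sec F U -> sec G U) : Prop :=
  (forall U (a : O U) (s t : sec F U), zopen_in X U ->
     phi U (a *: s + t) = a *: phi U s + phi U t) /\
  (forall U V (s : sec F U), zopen_in X U -> zopen_in X V -> V `<=` U ->
     phi V (res V s) = res V (phi U s)).

(* Coherence in the sense of Serre: F is of finite type, and so is the kernel of
   every morphism O_U^r -> F|_U. *)
Definition finite_type F : Prop :=
  forall p, X p -> exists V, [/\ zopen_in X V, V p &
    exists k (e : 'I_k -> sec F V),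
    forall N (s : sec F N) q, zopen_in X N -> N `<=` V -> N q ->
    exists N', [/\ zopen_in X N', N' `<=` N, N' q &
      exists a : 'I_k -> O N', res N' s = \sum_i a i *: res N' (e i)]].

Definition finite_relations F : Prop :=
  forall U r (s : 'I_r -> sec F U) p, zopen_in X U -> U p ->
  exists V, [/\ zopen_in X V, V `<=` U, V p &
    exists k (rho : 'I_k -> 'I_r -> O V),
    (forall j, \sum_i rho j i *: res V (s i) = 0) /\
    forall N (c : 'I_r -> O N) q, zopen_in X N -> N `<=` V -> N q ->
      \sum_i c i *: res N (s i) = 0 ->
      exists N', [/\ zopen_in X N', N' `<=` N, N' q &
        exists a : 'I_k -> O N', forall i x, N' x ->
          c i x = \sum_j a j x * rho j i x]].

Definition coherent F : Prop := finite_type F /\ finite_relations F.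

Definition open_cover (A : Type) (U : A -> set PP) : Prop :=
  (forall a, zopen_in X (U a)) /\ X = \bigcup_a U a.

Definition cochain1 F (A : Type) (U : A -> set PP) : Type :=
  forall a b, sec F (U a `&` U b).

Definition cocycle1 F A (U : A -> set PP) (c : cochain1 F U) : Prop :=
  forall a b d, let T := U a `&` U b `&` U d in
    res T (c a b) + res T (c b d) = res T (c a d).

(* H^1(X, F) is the direct limit of the Cech groups H^1(U, F) over all open
   covers U of X.  Accordingly, a linear form on H^1(X, F) is a family of
   linear forms on the spaces of 1-cocycles, vanishing on coboundaries and
   compatible with refinement. *)
Definition h1_form F : Type :=
  forall (A : Type) (U : A -> set PP), cochain1 F U -> K.

Definition is_h1_form F (l : h1_form F) : Prop :=
  [/\ forall A (U : A -> set PP) (k : K) (c c' : cochain1 F U), open_cover U ->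
        cocycle1 c -> cocycle1 c' ->
        l A U (fun a b => Ocst (U a `&` U b) k *: c a b + c' a b)
          = k * l A U c + l A U c',
      forall A (U : A -> set PP) (e : forall a, sec F (U a)), open_cover U ->
        l A U (fun a b => res (U a `&` U b) (e b) - res (U a `&` U b) (e a)) = 0
    & forall A B (U : A -> set PP) (V : B -> set PP) (tau : B -> A)
        (c : cochain1 F U), open_cover U -> open_cover V ->
        (forall b, V b `<=` U (tau b)) -> cocycle1 c ->
        l B V (fun a b => res (V a `&` V b) (c (tau a) (tau b))) = l A U c].

Definition induces F G (phi : forall U, sec F U -> sec G U)
    (tr : h1_form G) (l : h1_form F) : Prop :=
  forall A (U : A -> set PP) (c : cochain1 F U), open_cover U -> cocycle1 c ->
    l A U c = tr A U (fun a b => phi _ (c a b)).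

(* D is a dualizing sheaf of the 1-dimensional X: for a suitable trace
   tr : H^1(X, D) -> K and every coherent F, the pairing
   Hom(F, D) x H^1(X, F) -> H^1(X, D) -> K induces an isomorphism of
   Hom(F, D) with the dual of H^1(X, F). *)
Definition dualizing_sheaf (D : omodule X) : Prop :=
  coherent D /\
  exists2 tr : h1_form D, is_h1_form tr &
  forall F, coherent F -> forall l : h1_form F, is_h1_form l ->
    (exists2 phi, is_hom phi & induces phi tr l) /\
    (forall phi psi : forall U, sec F U -> sec D U, is_hom phi -> is_hom psi ->
       induces phi tr l -> induces psi tr l ->
       forall U (s : sec F U), zopen_in X U -> phi U s = psi U s).

End Modules.

(* A line bundle is given by an open cover and transition functions
   g_ij in O^*(U_i /\ U_j); invertibility follows from the cocycle rule. *)
Record line_bundle (K : fieldType) (n : nat) (X : set (pspace K n)) :=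
LineBundle {
  lb_idx : Type;
  lb_open : lb_idx -> set (pspace K n);
  lb_trans : lb_idx -> lb_idx -> fn K n;
  lb_openP : forall i, zopen_in X (lb_open i);
  lb_cover : X = \bigcup_i lb_open i;
  lb_regular : forall i j, regular (lb_open i `&` lb_open j) (lb_trans i j);
  lb_trans1 : forall i p, lb_open i p -> lb_trans i i p = 1;
  lb_transM : forall i j k p, lb_open i p -> lb_open j p -> lb_open k p ->
    lb_trans i j p * lb_trans j k p = lb_trans i k p
}.

Arguments lb_regular {K n X} l i j.

Section LineBundles.
Context {K : fieldType} {n : nat}.
Local Notation PP := (pspace K n).
Implicit Types (X Z U V : set PP).

Lemma lb_trans_neq0 X (L : line_bundle X) (i j : lb_idx L) p :
  lb_open i p -> lb_open j p -> lb_trans i j p != 0.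
Proof.
move=> Ui Uj; have := lb_transM Ui Uj Ui; rewrite lb_trans1 // => h.
by apply/eqP => g0; move: h; rewrite g0 mul0r => /eqP; rewrite eq_sym oner_eq0.
Qed.

(* Sections over an open subset U of X: families s_i in O(U /\ U_i) with
   s_i = g_ij s_j. *)
Definition secpred X (L : line_bundle X) U : {pred lb_idx L -> fn K n} :=
  fun s => `[< (forall i, s i \in regpred (U `&` lb_open i)) /\
    forall i j p, U p -> lb_open i p -> lb_open j p ->
      s i p = lb_trans i j p * s j p >].
Arguments secpred {X} L U.

Lemma secpred_zmod X (L : line_bundle X) U : zmod_closed (secpred L U).
Proof.
split=> [|s t].
  apply/asboolP; split=> [i|i j p *]; first exact: (rpred0 (regpred (U `&` lb_open i))).
  exact: esym (mulr0 _).
move=> /asboolP[rs hs] /asboolP[rt ht]; apply/asboolP; split=> [i|i j p *].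
  exact: (rpredB (rs i) (rt i)).
by rewrite -[LHS]/(s i p - t i p) (hs i j) // (ht i j) // -mulrBr.
Qed.

HB.instance Definition _ X (L : line_bundle X) U :=
  GRing.isZmodClosed.Build (lb_idx L -> fn K n) (secpred L U)
    (@secpred_zmod X L U).

Record lbsec X (L : line_bundle X) U :=
  MkLbsec { lbval :> lb_idx L -> fn K n; lbvalP : lbval \in secpred L U }.

HB.instance Definition _ X (L : line_bundle X) U := [isSub for @lbval X L U].
HB.instance Definition _ X (L : line_bundle X) U := [Choice of lbsec L U by <:].
HB.instance Definition _ X (L : line_bundle X) U :=
  [SubChoice_isSubZmodule of lbsec L U by <:].

Lemma lbsec_ext X (L : line_bundle X) U (s t : lbsec L U) :
  (forall i p, U p -> lb_open i p -> s i p = t i p) -> s = t.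
Proof.
move=> st; apply/val_inj/funext => i; apply/funext => p /=.
have [[Up Ui]|Up] := pselect ((U `&` lb_open i) p); first exact: st.
have /asboolP[/(_ i)/asboolP[_ s0] _] := lbvalP s.
have /asboolP[/(_ i)/asboolP[_ t0] _] := lbvalP t.
by rewrite s0 // t0.
Qed.

Lemma lbscale_subproof X (L : line_bundle X) U (a : O U) (s : lbsec L U) :
  (fun i p => a p * s i p) \in secpred L U.
Proof.
have /asboolP[ra _] := ovalP a; have /asboolP[rs hs] := lbvalP s.
apply/asboolP; split=> [i|i j p Up Ui Uj]; last by rewrite (hs i j) // mulrCA.
have /asboolP[rsi s0] := rs i; apply/asboolP; split.
  by apply: regularM => //; apply: regular_sub ra => p [].
by move=> p Up; rewrite s0 // mulr0.
Qed.

Definition lbscale X (L : line_bundle X) U (a : O U) (s : lbsec L U) :=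
  MkLbsec (lbscale_subproof a s).

Section Lmod.
Context {X : set PP} (L : line_bundle X) (U : set PP).

Lemma lbscaleA (a b : O U) (s : lbsec L U) :
  lbscale a (lbscale b s) = lbscale (a * b) s.
Proof. by apply: lbsec_ext => i p _ _ /=; rewrite mulrA. Qed.
Lemma lbscale1 : left_id 1 (@lbscale X L U).
Proof.
by move=> s; apply: lbsec_ext => i p Up _ /=; rewrite cutoff_in // mul1r.
Qed.
Lemma lbscaleDr : right_distributive (@lbscale X L U) +%R.
Proof. by move=> a s t; apply: lbsec_ext => i p _ _ /=; rewrite !fctE mulrDr. Qed.
Lemma lbscaleDl (s : lbsec L U) : {morph (@lbscale X L U)^~ s : a b / a + b}.
Proof. by move=> a b; apply: lbsec_ext => i p _ _ /=; rewrite !fctE mulrDl. Qed.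

HB.instance Definition _ := GRing.Zmodule_isLmodule.Build (O U) (lbsec L U)
  lbscaleA lbscale1 lbscaleDr lbscaleDl.
End Lmod.

(* The restriction of s to V; it is only used for V contained in U. *)
Definition lbres X (L : line_bundle X) U V (s : lbsec L U) : lbsec L V :=
  insubd 0 (fun i => cutoff V (s i)).
Arguments lbres {X L U} V s.

Lemma secpred_cutoff X (L : line_bundle X) U V s : V `<=` U ->
  s \in secpred L U -> (fun i => cutoff V (s i)) \in secpred L V.
Proof.
move=> VU /asboolP[rs hs]; apply/asboolP; split=> [i|i j p Vp Ui Uj].
  have /asboolP[rsi s0] := rs i; apply/asboolP; split.
    apply: (@regular_ext _ _ _ (s i)); last first.
      by apply: regular_sub rsi => p [/VU].
    by move=> p [Vp _]; rewrite cutoff_in.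
  move=> p nVp; have [Vp|Vp] := pselect (V p); last by rewrite cutoff_out.
  by rewrite cutoff_in // s0 // => -[_ Uip]; exact: nVp.
by rewrite !cutoff_in //; apply: hs => //; exact: VU.
Qed.

Lemma lbresE X (L : line_bundle X) U V (s : lbsec L U) i p :
  V `<=` U -> V p -> lbres V s i p = s i p.
Proof.
move=> VU Vp; rewrite /lbres -[lbval _]/(val _) val_insubd.
by rewrite (secpred_cutoff VU (lbvalP s)) cutoff_in.
Qed.

Section Sheaf.
Context {X : set PP} (L : line_bundle X).

Lemma lbres_id U (s : lbsec L U) : zopen_in X U -> lbres U s = s.
Proof. by move=> _; apply: lbsec_ext => i p Up _; rewrite lbresE. Qed.

Lemma lbres_comp U V W (s : lbsec L U) :
  zopen_in X U -> zopen_in X V -> zopen_in X W -> V `<=` U -> W `<=` V ->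
  lbres W (lbres V s) = lbres W s.
Proof.
move=> _ _ _ VU WV; apply: lbsec_ext => i p Wp _.
by rewrite !lbresE //; [exact: subset_trans VU|exact: WV].
Qed.

Lemma lbresD U V (s t : lbsec L U) : zopen_in X U -> zopen_in X V -> V `<=` U ->
  lbres V (s + t) = lbres V s + lbres V t.
Proof.
by move=> _ _ VU; apply: lbsec_ext => i p Vp _; rewrite /= !fctE !lbresE.
Qed.

Lemma lbresZ U V (a : O U) (b : O V) (s : lbsec L U) :
  zopen_in X U -> zopen_in X V -> V `<=` U ->
  (forall p, V p -> a p = b p) -> lbres V (a *: s) = b *: lbres V s.
Proof.
by move=> _ _ VU ab; apply: lbsec_ext => i p Vp _; rewrite /= !lbresE //= ab.
Qed.

Lemma lbsec_separated (A : Type) (U : A -> set PP) V (s t : lbsec L V) :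
  zopen_in X V -> (forall a, zopen_in X (U a)) -> V = \bigcup_a U a ->
  (forall a, lbres (U a) s = lbres (U a) t) -> s = t.
Proof.
move=> _ _ VE st; have UV a : U a `<=` V by rewrite VE => p Up; exists a.
apply: lbsec_ext => i p; rewrite {1}VE => -[a _ Uap] _.
by rewrite -(lbresE s i (UV a) Uap) st lbresE.
Qed.

Lemma lbsec_glue (A : Type) (U : A -> set PP) V (s : forall a, lbsec L (U a)) :
  zopen_in X V -> (forall a, zopen_in X (U a)) -> V = \bigcup_a U a ->
  (forall a b, lbres (U a `&` U b) (s a) = lbres (U a `&` U b) (s b)) ->
  exists t : lbsec L V, forall a, lbres (U a) t = s a.
Proof.
move=> oV oU VE sE; have UV a : U a `<=` V by rewrite VE => p Up; exists a.
pose t i p : K^o := if pselect (exists a, U a p) is left h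
  then s (projT1 (cid h)) i p else 0.
have tE a i p : U a p -> t i p = s a i p.
  move=> Uap; rewrite /t; case: pselect => [h|[]]; last by exists a.
  case: (cid h) => b /= Ubp.
  by rewrite -(@lbresE _ _ _ (U b `&` U a) (s b)) // sE lbresE.
have tP : t \in secpred L V.
  apply/asboolP; split=> [i|i j p].
    apply/asboolP; split=> [p [Vp Uip]|p nVp].
      move: (Vp); rewrite {1}VE => -[a _ Uap].
      have /asboolP[/(_ i)/asboolP[r _] _] := lbvalP (s a).
      have [N [oN Np] [d [f [g [hf hg hfg]]]]] := r p (conj Uap Uip).
      have [N' oN' UE] := zopen_in_trace (oU a).
      exists (N `&` N').
        split; first exact: zopen_inI.
        by split=> //; move: Uap; rewrite UE => -[].
      exists d, f, g; split => // q [Nq N'q] [Vq Uiq].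
      have Uaq : U a q by rewrite UE; split => //; exact: zopen_in_sub Vq.
      by rewrite (tE a) //; apply: hfg.
    have [Vp|Vp] := pselect (V p); last first.
      by rewrite /t; case: pselect => // h; exfalso; case: h => a /UV.
    move: (Vp); rewrite {1}VE => -[a _ Uap]; rewrite (tE a) //.
    have /asboolP[/(_ i)/asboolP[_ s0] _] := lbvalP (s a).
    by apply: s0 => -[_ Uip]; exact: nVp.
  rewrite {1}VE => -[a _ Uap] Ui Uj; rewrite !(tE a) //.
  by have /asboolP[_ hs] := lbvalP (s a); exact: hs.
exists (MkLbsec tP) => a; apply: lbsec_ext => i p Uap _.
by rewrite lbresE //= (tE a).
Qed.

Definition lb_sheaf : omodule X :=
  OModule lbres_id lbres_comp lbresD lbresZ lbsec_separated lbsec_glue.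

End Sheaf.

Definition H0 X (L : line_bundle X) : set (lb_idx L -> fn K n) :=
  [set s | s \in secpred L X].
Arguments H0 {X} L.

(* The restriction map H^0(X, L) -> H^0(Z, L (x) O_Z), see restr_H0 below. *)
Definition restr Z (I : Type) (s : I -> fn K n) : I -> fn K n :=
  fun i => cutoff Z (s i).

Section Restriction.
Context {X : set PP} (L : line_bundle X) {Z : set PP} (ZX : Z `<=` X).

Lemma lb_restr_open (i : lb_idx L) : zopen_in Z (lb_open i `&` Z).
Proof. exact: zopen_in_restr (lb_openP i). Qed.

Lemma lb_restr_cover : Z = \bigcup_(i : lb_idx L) (lb_open i `&` Z).
Proof.
by rewrite -setI_bigcupl -lb_cover; apply/esym/setIidr.
Qed.

Lemma lb_restr_regular (i j : lb_idx L) :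
  regular ((lb_open i `&` Z) `&` (lb_open j `&` Z)) (lb_trans i j).
Proof. by apply: (regular_sub _ (lb_regular L i j)) => p [[? _] [? _]]. Qed.

Lemma lb_restr_trans1 (i : lb_idx L) p :
  (lb_open i `&` Z) p -> lb_trans i i p = 1.
Proof. by move=> [Ui _]; exact: lb_trans1. Qed.

Lemma lb_restr_transM (i j k : lb_idx L) p : (lb_open i `&` Z) p ->
  (lb_open j `&` Z) p -> (lb_open k `&` Z) p ->
  lb_trans i j p * lb_trans j k p = lb_trans i k p.
Proof. by move=> [Ui _] [Uj _] [Uk _]; exact: lb_transM. Qed.

Definition lb_restr : line_bundle Z := LineBundle lb_restr_open lb_restr_cover
  lb_restr_regular lb_restr_trans1 lb_restr_transM.

Lemma restr_H0 s : H0 L s -> H0 lb_restr (restr Z s).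
Proof.
move=> /asboolP[rs hs]; apply/asboolP; split=> [i|i j p Zp [Ui _] [Uj _]].
  have /asboolP[r s0] := rs i; apply/asboolP; split.
    apply: (@regular_ext _ _ _ (s i)).
      by move=> p [Zp _]; rewrite /restr cutoff_in.
    by apply: regular_sub r => p [Zp [Uip _]]; split => //; exact: ZX.
  move=> p nZp; rewrite /restr.
  have [Zp|Zp] := pselect (Z p); last by rewrite cutoff_out.
  by rewrite cutoff_in // s0 // => -[_ Uip]; apply: nZp; split.
by rewrite /restr !cutoff_in //; apply: hs => //; exact: ZX.
Qed.
End Restriction.

Section Twist.
Context {X : set PP} (E L : line_bundle X) (q : int).
Let I : Type := (lb_idx E * lb_idx L)%type.
Let W (i : I) := lb_open i.1 `&` lb_open i.2.
Let g (i j : I) : fn K n :=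
  fun p => lb_trans i.1 j.1 p * (lb_trans i.2 j.2 p : K) ^ q.

Lemma twist_open i : zopen_in X (W i).
Proof. by apply: zopen_inI; exact: lb_openP. Qed.

Lemma twist_cover : X = \bigcup_i W i.
Proof.
apply/seteqP; split => [p Xp|p [i _]]; last by move/(zopen_in_sub (twist_open i)).
have [i _ Ui] : (\bigcup_i lb_open (l := E) i) p by rewrite -lb_cover.
have [j _ Uj] : (\bigcup_j lb_open (l := L) j) p by rewrite -lb_cover.
by exists (i, j).
Qed.

Lemma twist_regular i j : regular (W i `&` W j) (g i j).
Proof.
apply: regularM; first by apply: (regular_sub _ (lb_regular E i.1 j.1)) => p [[? _] [? _]].
apply: regularXz; first by move=> p [[_ ?] [_ ?]]; exact: lb_trans_neq0.
by apply: (regular_sub _ (lb_regular L i.2 j.2)) => p [[_ ?] [_ ?]].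
Qed.

Lemma twist_trans1 i p : W i p -> g i i p = 1.
Proof. by move=> [U1 U2]; rewrite /g !lb_trans1 // exp1rz mulr1. Qed.

Lemma twist_transM i j k p : W i p -> W j p -> W k p ->
  g i j p * g j k p = g i k p.
Proof.
move=> [? ?] [? ?] [? ?]; rewrite /g mulrACA -expfzMl.
by congr (_ * _ ^ _); exact: lb_transM.
Qed.

(* E (x) L^q *)
Definition twist : line_bundle X := LineBundle twist_open twist_cover
  twist_regular twist_trans1 twist_transM.
End Twist.

End LineBundles.

Arguments secpred {K n X} L U.
Arguments lbres {K n X L U} V s.
Arguments H0 {K n X} L.
Arguments restr {K n} Z {I} s.

Definition is_basis (K : fieldType) (V : lmodType K) (S : set V) (d : nat)
    (e : 'I_d -> V) : Prop :=
  (forall c : 'I_d -> K, \sum_i c i *: e i = 0 -> forall i, c i = 0) /\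
  S = [set v | exists c : 'I_d -> K, v = \sum_i c i *: e i].

Definition has_dim (K : fieldType) (V : lmodType K) (S : set V) (d : nat) :
  Prop := exists e : 'I_d -> V, is_basis S e.

Section Koszul.
Context {K : fieldType} {n : nat} {X : set (pspace K n)} (E L : line_bundle X).
Local Notation ambient := (lb_idx E * lb_idx L -> fn K n).

Section Complex.
Context {m : nat} (w : 'I_m -> lb_idx L -> fn K n).

(* If w is a basis of W, the products e_S of the basis vectors indexed by
   S with #|S| = p form a basis of the p-th exterior power of W, and an element
   of Lambda^p W (x) H^0(E (x) L^q) is the family of its coefficients on the
   e_S.  The differential sends e_S (x) s to the sum over i in S of
   (-1)^#{j in S | j < i} e_(S \ i) (x) w_i s. *)
Definition koszul_chain (p q : int) (a : {set 'I_m} -> ambient) : Prop :=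
  forall S : {set 'I_m},
    if #|S|%:Z == p then H0 (twist E L q) (a S) else a S = 0.

Definition koszul_d (a : {set 'I_m} -> ambient) (T : {set 'I_m}) : ambient :=
  fun i x => \sum_(k < m | k \notin T)
    (-1) ^+ #|[set j in T | (j < k)%N]| * (w k i.2 x * a (k |: T) i x).

End Complex.

(* K_{p,q}(X, E, L, W) = 0: the complex
   Lambda^(p+1) W (x) H^0(E (x) L^(q-1)) -> Lambda^p W (x) H^0(E (x) L^q)
     -> Lambda^(p-1) W (x) H^0(E (x) L^(q+1)) is exact in the middle.  A basis of
   W only serves to write down the complex; the choice is immaterial. *)
Definition koszul_cohomology_zero (W : set (lb_idx L -> fn K n)) (p q : int) :
  Prop :=
  forall (m : nat) (w : 'I_m -> lb_idx L -> fn K n), is_basis W w ->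
  forall a, koszul_chain p q a -> koszul_d w a = 0 ->
  exists2 b, koszul_chain (p + 1) (q - 1) b & koszul_d w b = a.

End Koszul.

Arguments koszul_cohomology_zero {K n X} E L W p q.

Section Lci.
Context {K : fieldType} {n : nat}.
Local Notation PP := (pspace K n).
Implicit Types (X Y Z V N : set PP) (J : set PP -> set (fn K n)).

(* J is an ideal sheaf on Y (J N is a set of functions regular on N, for N open
   in Y); over V it is generated, as a sheaf, by f_1, ..., f_r. *)
Definition generates Y J V (r : nat) (f : 'I_r -> fn K n) : Prop :=
  (forall i, J V (f i)) /\
  forall N h x, zopen_in Y N -> N `<=` V -> J N h -> N x ->
  exists N', [/\ zopen_in Y N', N' `<=` N, N' x &
    exists2 a : 'I_r -> fn K n, (forall i, regular N' (a i)) &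
      forall y, N' y -> h y = \sum_i a i y * f i y].

Definition vanishing_ideal Z N : set (fn K n) :=
  [set h | regular N h /\ forall x, N x -> Z x -> h x = 0].

(* local complete intersection of pure dimension d in P^n *)
Definition lci (d : nat) Z : Prop :=
  forall p, Z p -> exists V, [/\ zopen_in setT V, V p &
    exists f : 'I_(n - d) -> fn K n, generates setT (vanishing_ideal Z) V f].

(* For N open in a closed subset Z of X: sections over N of the ideal sheaf on Z
   of the scheme-theoretic intersection of Z and Z' inside X, i.e. of the image
   in O_Z of the ideal sheaf of Z' in O_X. *)
Definition intersection_ideal X Z' N : set (fn K n) :=
  [set h | regular N h /\ forall x, N x ->
    exists N', [/\ zopen_in X N', N' x &
      exists2 h', vanishing_ideal Z' N' h' &
        forall y, N' y -> N y -> h' y = h y]].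

Definition nonzerodivisor Z V (f : fn K n) : Prop :=
  forall N a, zopen_in Z N -> N `<=` V -> regular N a ->
    (forall x, N x -> a x * f x = 0) -> forall x, N x -> a x = 0.

(* The closed subscheme of Z with ideal sheaf J is an effective Cartier divisor:
   J is locally generated by one nonzerodivisor. *)
Definition cartier_divisor Z J : Prop :=
  forall p, Z p -> exists V f, [/\ zopen_in Z V, V p, regular V f,
    nonzerodivisor Z V f & generates Z J V (fun _ : 'I_1 => f)].

Definition deeply_lci_curve X : Prop :=
  is_curve X /\
  forall Z, component_sum X Z ->
    lci 1 Z /\
    cartier_divisor Z (intersection_ideal X (complementary X Z)).

End Lci.

(* Main.v *)
Require Import Defs.
From HB Require Import structures.
From mathcomp Require Import all_boot all_order all_algebra.
From mathcomp Require Import mathcomp_extra boolp classical_sets functions.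
From mathcomp Require Import filter reals complex mpoly.

Set Implicit Arguments.
Unset Strict Implicit.
Unset Printing Implicit Defensive.

Import Order.TTheory GRing.Theory Num.Theory.

Local Open Scope classical_set_scope.
Local Open Scope ring_scope.

(** Why the theorem holds.  In the stated range of [t] a cycle [a] is zero,
    so it is a boundary for trivial reasons.

    Think of [a] as a section with values in the [t]-th exterior power of [W].
    The Koszul differential, evaluated at a point [x], is the contraction of
    [a x] with the evaluation functional of [x] on [W]; so [a] is a cycle if and
    only if, at every [x], the value of [a] at [x] is annihilated by contraction
    with evaluation at [x].

    Fix a component [Z], and let [d] be the dimension of the restriction of [W]
    to [Z] and [g] that of the space of restrictions to [Z] of global sections
    of [omega].  As [Z] is irreducible, one can choose [d] points of [Z] whose
    evaluation functionals on [W] are independent and such that any [g] of them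
    separate the [g]-dimensional space of restrictions
    ([exists_general_position]).  Complete these [d] functionals to a basis of
    the dual of [W] by [m - d] others.  Contract [a] with [t] distinct members
    of this basis: contractions anticommute, so the outcome, a section of
    [omega], vanishes at each chosen point whose functional was used, and there
    are at least [t - (m - d)], hence at least [g], of those.  So it vanishes
    on [Z].  These contractions determine [a], so [a] vanishes on [Z]
    ([contr_general_position], [cycle_zero_on_component]).

    Every point of [X] lies on a component ([exists_component]), hence [a] is
    zero. *)

(** * Vectors in general position *)

Definition general_position (K : fieldType) d N (v : 'I_N -> 'rV[K]_d) : Prop :=
  forall (A : {set 'I_N}) (u : 'rV_d), (d <= #|A|)%N ->
    (forall i, i \in A -> u *m (v i)^T = 0) -> u = 0.

Section GeneralPosition.
Context {K : fieldType} {P : Type} (F : set_system P).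

(** The image of [psi] spans, in a strong sense: it leaves every hyperplane at
    [F]-almost all points.  With the filter of nonempty Zariski open sets of an
    irreducible variety, this says that no nontrivial combination of the
    coordinates of [psi] vanishes identically. *)
Definition nondegenerate d (psi : P -> 'rV[K]_d) : Prop :=
  forall c : 'cV_d, c != 0 -> F [set x | psi x *m c != 0].

Definition list_span d (psi : P -> 'rV[K]_d) (s : seq P) : 'M[K]_d :=
  (\sum_(x <- s) <<psi x>>)%MS.

(** The form of general position suited to adding points one at a time: a
    selection of the list, given by a mask, spans a subspace of the largest
    dimension that its length permits. *)
Definition list_general d (psi : P -> 'rV[K]_d) (s : seq P) : Prop :=
  forall b : bitseq, size b = size s ->
    (minn d (count id b) <= \rank (list_span psi (mask b s)))%N.

(** A subspace [M] that is not the whole space lies in some hyperplane, and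
    almost every [psi x] avoids that hyperplane, hence enlarges [M]. *)
Lemma nondegenerate_rank {FF : Filter F} d (psi : P -> 'rV[K]_d)
    (M : 'M[K]_d) k :
  nondegenerate psi -> (minn d k <= \rank M)%N ->
  F [set x | (minn d k.+1 <= \rank (<<psi x>> + M)%MS)%N].
Proof.
move=> nd dk; have [Mfull|Mnfull] := eqVneq (\rank M) d.
  apply: filterE => x /=; rewrite geq_min; apply/orP; left.
  by rewrite -[leqLHS]Mfull mxrankS // addsmxSr.
have /matrix0Pn[i [j Mij]] : cokermx M != 0.
  rewrite -mxrank_eq0 mxrank_coker subn_eq0 -ltnNge ltn_neqAle Mnfull.
  exact: rank_leq_col.
have c0 : col j (cokermx M) != 0.
  by apply/matrix0Pn; exists i, 0; rewrite mxE.
apply: filterS (nd _ c0) => x /= xc.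
suff /rank_ltmx Mlt : (M < <<psi x>> + M)%MS.
  apply: leq_trans Mlt; apply: leq_trans (_ : (minn d k).+1 <= _)%N => //.
  by rewrite -minnSS leq_min !geq_min leqnSn leqnn orbT.
rewrite ltmxE addsmxSr; apply: contra xc => xM.
have /submxP[D ->] : (psi x <= M)%MS.
  by apply: submx_trans xM; rewrite (submx_trans _ (addsmxSl _ _)) ?genmxE.
by rewrite colE -mulmxA (mulmxA M) mulmx_coker mul0mx mulmx0.
Qed.

(** Only finitely many selections of [s] are extended by the new point, so the
    conditions on that point are finitely many. *)
Lemma list_general_cons {FF : Filter F} d (psi : P -> 'rV[K]_d) s :
  nondegenerate psi -> list_general psi s ->
  F [set x | list_general psi (x :: s)].
Proof.
move=> nd gs.
have H : F [set x | forall b : (size s).-tuple bool,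
    (minn d (count id b).+1 <=
      \rank (<<psi x>> + list_span psi (mask b s))%MS)%N].
  apply: filter_forall => b; apply: nondegenerate_rank => //.
  by apply: gs; rewrite size_tuple.
apply: filterS H => x /= gx [|[] b] //= [bs]; last exact: gs.
rewrite /list_span big_cons add1n.
by have := gx (tcast bs (in_tuple b)); rewrite val_tcast.
Qed.

Lemma list_general_tuple d N (psi : P -> 'rV[K]_d) (s : N.-tuple P) :
  list_general psi s -> general_position (fun i => psi (tnth s i)).
Proof.
move=> gs A u dA uA; pose b := [seq i \in A | i <- enum 'I_N].
have maskE : mask b s = [seq tnth s i | i <- enum A].
  rewrite -[X in mask _ X]map_tnth_enum -map_mask -filter_mask.
  by rewrite enumT.
have countE : count id b = #|A|.
  by rewrite count_map enumT cardE size_filter.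
have := gs b; rewrite size_map size_enum_ord size_tuple => /(_ erefl).
rewrite countE (minn_idPl dA) maskE /list_span big_map big_enum /= => rk.
have : (1%:M <= kermx u^T)%MS.
  apply: submx_trans (_ : (\sum_(i in A) <<psi (tnth s i)>> <= _)%MS).
    by apply: submx_full; rewrite /row_full eqn_leq rank_leq_col.
  apply/sumsmx_subP => i iA; rewrite genmxE; apply/sub_kermxP.
  by rewrite -[LHS]trmxK trmx_mul trmxK uA // trmx0.
by move/sub_kermxP; rewrite mul1mx => /(canRL (@trmxK _ _ _)); rewrite trmx0.
Qed.

(** The two families are tested at the same points; below they are the values of
    the sections in [W] and of the sections of [omega]. *)
Lemma exists_general_position {FF : ProperFilter F} d1 d2
    (psi1 : P -> 'rV[K]_d1) (psi2 : P -> 'rV[K]_d2) (D : set P) N :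
  F D -> nondegenerate psi1 -> nondegenerate psi2 ->
  exists x : 'I_N -> P, [/\ forall i, D (x i),
    general_position (psi1 \o x) & general_position (psi2 \o x)].
Proof.
move=> FD nd1 nd2.
suff [s [Ds g1 g2]] : exists s : N.-tuple P,
    [/\ all (fun x => `[< D x >]) s, list_general psi1 s & list_general psi2 s].
  exists (tnth s); split=> [i||]; [|exact: list_general_tuple..].
  by move/all_tnthP: Ds => /(_ i) /asboolP.
elim: N => [|N [s [Ds g1 g2]]].
  by exists [tuple]; split=> // -[] // _; rewrite minn0.
have [x [[Dx x1] x2]] := filter_ex (filterI (filterI FD
  (list_general_cons nd1 g1)) (list_general_cons nd2 g2)).
by exists (cons_tuple x s); split=> //=; rewrite Ds andbT; apply/asboolP.
Qed.

End GeneralPosition.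

(** * Contraction of alternating tensors *)

Section Contraction.
Context {K : fieldType} {m : nat}.
Implicit Types (V : lmodType K) (phi psi : 'rV[K]_m) (S T : {set 'I_m}).

(** A family [a] indexed by the subsets of ['I_m] stands for the tensor whose
    coefficient on the product of the basis vectors in [S] is [a S]; [phi] is a
    functional, given by its values on the basis. *)
Definition contr V phi (a : {set 'I_m} -> V) (T : {set 'I_m}) : V :=
  \sum_(k < m | k \notin T)
    ((-1) ^+ #|[set j in T | (j < k)%N]| * phi 0 k) *: a (k |: T).

Lemma eq_contr V phi (a b : {set 'I_m} -> V) :
  a =1 b -> contr phi a =1 contr phi b.
Proof. by move=> ab T; apply: eq_bigr => k _; rewrite ab. Qed.

Lemma contr0 V phi (a : {set 'I_m} -> V) :
  a =1 (fun=> 0) -> contr phi a =1 (fun=> 0).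
Proof. by move=> a0 T; rewrite /contr big1 // => k _; rewrite a0 scaler0. Qed.

Lemma contrD V phi (a b : {set 'I_m} -> V) T :
  contr phi (fun S => a S + b S) T = contr phi a T + contr phi b T.
Proof. by rewrite -big_split; apply: eq_bigr => k _; rewrite scalerDr. Qed.

Lemma contrDl V phi psi (a : {set 'I_m} -> V) T :
  contr (phi + psi) a T = contr phi a T + contr psi a T.
Proof.
by rewrite -big_split; apply: eq_bigr => k _; rewrite mxE mulrDr scalerDl.
Qed.

Lemma contrZl V (c : K) phi (a : {set 'I_m} -> V) T :
  contr (c *: phi) a T = c *: contr phi a T.
Proof.
by rewrite scaler_sumr; apply: eq_bigr => k _; rewrite mxE scalerA mulrCA.
Qed.

Lemma contr_suml V (I : Type) (r : seq I) (phi : I -> 'rV[K]_m)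
    (a : {set 'I_m} -> V) T :
  contr (\sum_(i <- r) phi i) a T = \sum_(i <- r) contr (phi i) a T.
Proof.
elim: r => [|i r IH]; last by rewrite !big_cons contrDl IH.
by rewrite !big_nil /contr big1 // => k _; rewrite mxE mulr0 scale0r.
Qed.

Lemma contr_sum V (I : Type) (r : seq I) phi (a : I -> {set 'I_m} -> V) T :
  contr phi (fun S => \sum_(i <- r) a i S) T = \sum_(i <- r) contr phi (a i) T.
Proof.
rewrite [RHS]exchange_big /=; apply: eq_bigr => k _; exact: scaler_sumr.
Qed.

Lemma contrZ V (c : K) phi (a : {set 'I_m} -> V) T :
  contr phi (fun S => c *: a S) T = c *: contr phi a T.
Proof.
by rewrite scaler_sumr; apply: eq_bigr => k _; rewrite !scalerA mulrC.
Qed.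

Lemma linear_contr V (U : lmodType K) (f : {linear V -> U}) phi
    (a : {set 'I_m} -> V) T :
  f (contr phi a T) = contr phi (f \o a) T.
Proof. by rewrite linear_sum; apply: eq_bigr => k _; rewrite linearZ. Qed.

Lemma contr_delta V (k : 'I_m) (a : {set 'I_m} -> V) T : k \notin T ->
  contr (delta_mx 0 k) a T = (-1) ^+ #|[set j in T | (j < k)%N]| *: a (k |: T).
Proof.
move=> kT; rewrite /contr (bigD1 k) //= mxE !eqxx mulr1 big1 ?addr0 // => l.
by move=> /andP[_ /negPf lk]; rewrite mxE lk andbF mulr0 scale0r.
Qed.

Lemma sum_antisym (V : zmodType) (F : 'I_m -> 'I_m -> V) :
  (forall k, F k k = 0) ->
  (forall k l : 'I_m, (k < l)%N -> F k l + F l k = 0) ->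
  \sum_k \sum_l F k l = 0.
Proof.
move=> F0 Fa; transitivity
  (\sum_(k < m) (\sum_(l < m | (k < l)%N) F k l +
                 \sum_(l < m | (l < k)%N) F k l)).
  apply: eq_bigr => k _; rewrite (bigID (fun l : 'I_m => (k < l)%N)) /=.
  congr +%R; rewrite (bigD1 k) ?ltnn //= F0 add0r; apply: eq_bigl => l.
  by rewrite -leqNgt ltn_neqAle andbC.
rewrite big_split /= [X in _ + X](exchange_big_dep predT) //=.
rewrite -big_split big1 //=.
by move=> k _; rewrite -big_split big1 //= => l /Fa.
Qed.

(** Removing [k] and then [l], or [l] and then [k], with [k < l], gives opposite
    signs: the sign of the removal of [l] counts [k] in one case only. *)
Lemma contr_contr V phi (a : {set 'I_m} -> V) T : contr phi (contr phi a) T = 0.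
Proof.
pose c (U : {set 'I_m}) (k : 'I_m) : K :=
  (-1) ^+ #|[set j in U | (j < k)%N]| * phi 0 k.
pose F k l := if [&& k \notin T, l \notin T & k != l] then
  (c T k * c (k |: T) l) *: a (l |: (k |: T)) else 0.
transitivity (\sum_k \sum_l F k l).
  rewrite /contr big_mkcond; apply: eq_bigr => k _.
  case: ifP => kT; last by rewrite big1 // => l _; rewrite /F kT.
  rewrite scaler_sumr big_mkcond; apply: eq_bigr => l _; rewrite /F kT.
  rewrite finset.in_setU1 negb_or eq_sym andbC.
  by case: ifP => // _; rewrite scalerA.
apply: sum_antisym => [k|k l kl]; first by rewrite /F eqxx !andbF.
rewrite /F (eq_sym l) andbCA.
case: ifP => [/and3P[lT kT _]|]; last by rewrite addr0.
rewrite finset.setUCA -scalerDl.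
suff -> : c T l * c (l |: T) k = - (c T k * c (k |: T) l).
  by rewrite subrr scale0r.
have -> : c (l |: T) k = c T k.
  rewrite /c; congr (_ ^+ #|pred_of_set _| * _); apply/setP => j.
  by rewrite !inE; case: eqP => // ->; rewrite (negPf lT) ltnNge ltnW.
suff -> : c (k |: T) l = - c T l by rewrite mulrN opprK mulrC.
rewrite /c (_ : [set _ in _ | _] = k |: [set j in T | (j < l)%N]); last first.
  by apply/setP => j; rewrite !inE; case: eqP => // ->.
by rewrite cardsU1 inE (negPf kT) exprS mulN1r mulNr.
Qed.

Lemma contr_anticomm V phi psi (a : {set 'I_m} -> V) T :
  contr psi (contr phi a) T = - contr phi (contr psi a) T.
Proof.
apply/eqP; rewrite -addr_eq0; apply/eqP.
have := contr_contr (phi + psi) a T.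
rewrite contrDl !(eq_contr _ (contrDl phi psi a)) !contrD !contr_contr.
by rewrite add0r addr0 addrC.
Qed.

(** The functional at the head of the list is contracted first. *)
Fixpoint contrs V (r : seq 'rV[K]_m) (a : {set 'I_m} -> V) : {set 'I_m} -> V :=
  if r is phi :: r' then contrs r' (contr phi a) else a.

Lemma eq_contrs V r (a b : {set 'I_m} -> V) :
  a =1 b -> contrs r a =1 contrs r b.
Proof. by elim: r a b => //= phi r IH a b ab; apply/IH/eq_contr. Qed.

Lemma contrs0 V r (a : {set 'I_m} -> V) :
  a =1 (fun=> 0) -> contrs r a =1 (fun=> 0).
Proof. by elim: r a => //= phi r IH a a0; apply/IH/contr0. Qed.

Lemma contrs_sum V r (I : Type) (s : seq I) (c : I -> K)
    (a : I -> {set 'I_m} -> V) T :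
  contrs r (fun S => \sum_(i <- s) c i *: a i S) T =
  \sum_(i <- s) c i *: contrs r (a i) T.
Proof.
elim: r a => //= phi r IH a; rewrite -IH; apply: eq_contrs => S.
by rewrite contr_sum; apply: eq_bigr => i _; rewrite contrZ.
Qed.

Lemma linear_contrs V (U : lmodType K) (f : {linear V -> U}) r
    (a : {set 'I_m} -> V) T :
  f (contrs r a T) = contrs r (f \o a) T.
Proof.
elim: r a => //= phi r IH a; rewrite IH; apply: eq_contrs => S /=.
exact: linear_contr.
Qed.

(** Anticommutation lets [phi] be contracted first, wherever it stands in [r]. *)
Lemma contrs_mem0 V r phi (a : {set 'I_m} -> V) :
  contr phi a =1 (fun=> 0) -> phi \in r -> contrs r a =1 (fun=> 0).
Proof.
elim: r a => //= psi r IH a a0; rewrite inE => /predU1P[<-|/IH].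
  exact: contrs0.
by apply=> T; rewrite contr_anticomm contr0 ?oppr0.
Qed.

Lemma contrs_dup V r (a : {set 'I_m} -> V) :
  ~~ uniq r -> contrs r a =1 (fun=> 0).
Proof.
elim: r a => //= phi r IH a; rewrite negb_and negbK => /orP[|/IH//].
by apply: contrs_mem0 => T; exact: contr_contr.
Qed.

(** Multilinearity: [t]-fold contractions, which end in degree 0, are determined
    by those with the members of a spanning family. *)
Lemma contrs_span V (J : finType) (phi : J -> 'rV[K]_m) (t : nat)
    (a : {set 'I_m} -> V) :
  (forall u, exists c : J -> K, u = \sum_j c j *: phi j) ->
  (forall r : seq J, size r = t -> contrs (map phi r) a finset.set0 = 0) ->
  forall r, size r = t -> contrs r a finset.set0 = 0.
Proof.
move=> phi_span; elim: t a => [|t IH] a a0.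
  by case=> // _; exact: (a0 [::]).
case=> // u r [rt] /=; apply: IH rt => s st.
have [c ->] := phi_span u.
rewrite (eq_contrs _ (b := fun S => \sum_j c j *: contr (phi j) a S));
  last first.
  by move=> S; rewrite contr_suml; apply: eq_bigr => j _; rewrite contrZl.
rewrite contrs_sum big1 // => j _.
by have /= -> := a0 (j :: s); rewrite ?scaler0 // st.
Qed.

(** Contracting with the coordinate functionals of the members of [S] extracts
    the coefficient [a S], up to sign. *)
Lemma contrs_eq0 V (t : nat) (a : {set 'I_m} -> V) :
  (forall r, size r = t -> contrs r a finset.set0 = 0) ->
  forall S, #|S| = t -> a S = 0.
Proof.
elim: t a => [|t IH] a a0 S.
  by move/eqP; rewrite cards_eq0 => /eqP ->; exact: (a0 [::]).
move=> St; have /card_gt0P[k kS] : (0 < #|S|)%N by rewrite St.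
have : contr (delta_mx 0 k) a (S :\ k) = 0.
  apply: IH => [r rt|]; first by apply: (a0 (delta_mx 0 k :: r)); rewrite /= rt.
  by move: St; rewrite (cardsD1 k) kS => -[].
rewrite contr_delta ?finset.setD11 // finset.setD1K // => /eqP.
by rewrite scaler_eq0 signr_eq0 => /eqP.
Qed.

Lemma row_free_completion (n : nat) (phi : 'I_n -> 'rV[K]_m) :
  row_free (\matrix_j phi j) ->
  exists k (psi : 'I_n + 'I_k -> 'rV[K]_m), [/\ (n + k = m)%N,
    forall i, psi (inl i) = phi i &
    forall u, exists c : 'I_n + 'I_k -> K, u = \sum_j c j *: psi j].
Proof.
set A := \matrix_j phi j => Afree; pose B := row_base (A^C)%MS.
exists (\rank (A^C)%MS),
  (fun j => match j with inl i => phi i | inr i => row i B end).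
split=> // [|u].
  by rewrite mxrank_compl (eqP Afree) subnKC // -(eqP Afree) rank_leq_col.
have : (u <= A + A^C)%MS by apply: submx_full; exact: addsmx_compl_full.
case/sub_addsmxP => -[u1 u2] /= ->.
have /submxP[D ->] : (u2 *m A^C <= B)%MS by rewrite eq_row_base submxMl.
exists (fun j => match j with inl i => u1 0 i | inr i => D 0 i end).
rewrite big_sumType /= !mulmx_sum_row; congr (_ + _).
by apply: eq_bigr => i _; rewrite rowK.
Qed.

Lemma size_uniq_sum (T1 T2 : finType) (r : seq (T1 + T2)%type) :
  uniq r -> (size r <= #|[set i | inl i \in r]%SET| + #|T2|)%N.
Proof.
move=> /card_uniqP <-; rewrite -!sum1_card big_sumType /= leq_add //.
  by apply/eq_leq/eq_bigl => i; rewrite inE.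
by rewrite big_mkcond; apply: leq_sum => i _; case: ifP.
Qed.

(** Green's argument, in coordinates.  The space of values, of dimension [g], is
    to be thought of as a space of sections, and [psi i] as the evaluation of
    these sections at a point [x i] at which the functional [phi i] is
    evaluation as well.  Among the [t] distinct functionals of a completed basis
    at most [m - n] are not of the form [phi i], so the resulting section
    vanishes at [g] or more of the points [x i]. *)
Lemma contr_general_position (g n t : nat) (phi : 'I_n -> 'rV[K]_m)
    (psi : 'I_n -> 'rV[K]_g) (a : {set 'I_m} -> 'rV[K]_g) :
  row_free (\matrix_i phi i) -> general_position psi ->
  (forall i, contr (phi i) (fun S => a S *m (psi i)^T) =1 (fun=> 0)) ->
  (g + m <= t + n)%N -> forall S, #|S| = t -> a S = 0.
Proof.
move=> phi_free psi_gp a0 gt.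
have [k [theta [nk thetaE span]]] := row_free_completion phi_free.
apply/contrs_eq0/(contrs_span span) => r rt.
have [ur|nur] := boolP (uniq (map theta r)); last exact: contrs_dup.
apply: (psi_gp [set i | inl i \in r]%SET) => [|i].
  have := size_uniq_sum (map_uniq ur); rewrite rt card_ord => rk.
  by rewrite -(leq_add2r m) (leq_trans gt) // -nk addnA addnAC leq_add2r.
rewrite inE => ir; rewrite -[LHS]/(mulmxr (psi i)^T _) linear_contrs.
apply: (@contrs_mem0 _ _ (phi i)); first exact: a0.
by rewrite -thetaE; apply: map_f.
Qed.

End Contraction.

(** * Components and generic points *)

Section Zariski.
Context {K : fieldType} {n : nat}.
Implicit Types (X Z A B C U V : set (pspace K n)) (p q : pspace K n).

Lemma zclosed_zero (a : {mpoly K[n.+1]}) d : a \is d.-homog ->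
  zclosed [set p | peval a p = 0].
Proof.
move=> ad; exists [set a] => [_ ->|]; first by exists d.
by apply/seteqP; split=> p /= h; [move=> _ ->|exact: h].
Qed.

Lemma zclosed_zclosure A : zclosed (zclosure A).
Proof.
exists [set a | (exists d, a \is d.-homog) /\ forall q, A q -> peval a q = 0].
  by move=> a [].
apply/seteqP; split=> p /= hp.
  by move=> a [[d ad] a0]; exact: hp (zclosed_zero ad) a0.
move=> C [T hT ->] AT a Ta; apply: hp; split; first exact: hT.
by move=> q /AT Tq; exact: Tq.
Qed.

Lemma sub_zclosure A : A `<=` zclosure A.
Proof. by move=> p Ap C _; exact. Qed.

Lemma zclosure_sub A C : zclosed C -> A `<=` C -> zclosure A `<=` C.
Proof. by move=> cC AC p; exact. Qed.

Lemma zirreducible1 p : zirreducible [set p].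
Proof.
split=> [|B C _ _ pBC]; first by exists p.
by case: (pBC p erefl) => h; [left|right] => _ ->.
Qed.

Lemma zirreducible_zclosure A : zirreducible A -> zirreducible (zclosure A).
Proof.
move=> [[p Ap] Airr]; split=> [|B C cB cC ABC].
  by exists p; exact: sub_zclosure.
have [AB|AC] := Airr B C cB cC (subset_trans (@sub_zclosure A) ABC).
  by left; exact: zclosure_sub.
by right; exact: zclosure_sub.
Qed.

(** Zorn's lemma on the subsets of [X] that become irreducible with [p] adjoined
    (adjoining [p] provides for the empty chain): the union of a chain of
    irreducible sets is irreducible, as two points that witness that it lies in
    neither of two closed sets already lie in one member.  The closure of a
    maximal such set is a component. *)
Lemma exists_component X p : zclosed X -> X p -> exists2 Z, component X Z & Z p.
Proof.
move=> cX Xp; pose P A := zirreducible (p |` A) /\ A `<=` X.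
have [F FP Ftot|A [[Airr AX] Amax]] := @Zorn_bigcup _ P.
  split; last by apply: bigcup_sub => A /FP[].
  split=> [|B C cB cC FBC]; first by exists p; left.
  apply: contrapT => /not_orP[/existsNP[b /not_implyP[bF Bb]]].
  move=> /existsNP[c /not_implyP[cF Cc]].
  suff [A [[_ /(_ B C cB cC) ABC] [AF [Ab Ac]]]] : exists A,
      zirreducible (p |` A) /\ A `<=` \bigcup_(X in F) X /\
      (p |` A) b /\ (p |` A) c.
    case: ABC => [|/(_ b Ab)//|/(_ c Ac)//].
    by apply: subset_trans FBC; exact: setUS.
  have FU A : F A -> zirreducible (p |` A) /\ A `<=` \bigcup_(X in F) X.
    by move=> FA; split; [have [] := FP A FA | exact: bigcup_sup].
  case: bF => [->|[A1 FA1 A1b]]; case: cF => [->|[A2 FA2 A2c]].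
  - by exists set0; rewrite setU0; split; [exact: zirreducible1 | split].
  - by exists A2; have [] := FU A2 FA2; do ![split=> //]; [left|right].
  - by exists A1; have [] := FU A1 FA1; do ![split=> //]; [right|left].
  have [A12|A21] := Ftot A1 A2 FA1 FA2.
    by exists A2; have [] := FU A2 FA2; do ![split=> //]; right=> //; exact: A12.
  by exists A1; have [] := FU A1 FA1; do ![split=> //]; right=> //; exact: A21.
have pAX : p |` A `<=` X by move=> q [->|/AX].
exists (zclosure (p |` A)); last by apply: sub_zclosure; left.
split; [exact: zclosed_zclosure|exact: zirreducible_zclosure|exact: zclosure_sub|].
move=> B cB Birr AB BX; apply/seteqP; split=> //.
have {}AB : p |` A `<=` B := subset_trans (@sub_zclosure _) AB.
have AB' : A `<=` B by move=> q Aq; apply: AB; right.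
suff BA : B `<=` A by move=> q /BA Aq; apply: sub_zclosure; right.
apply: contrapT => nBA; apply: (Amax B); first by split.
by split=> //; rewrite (setUidr _) // => _ ->; apply: AB; left.
Qed.

(** The filter of the sets that contain a nonempty Zariski open subset of [Z].
    That it is a proper filter expresses the irreducibility of [Z]. *)
Definition generic Z : set_system (pspace K n) :=
  [set D | exists2 V, zopen_in setT V & Z `&` V !=set0 /\ Z `&` V `<=` D].

Lemma generic_proper Z : zirreducible Z -> ProperFilter (generic Z).
Proof.
move=> [[p Zp] Zirr]; split; first by move=> [V _ [[q Vq] /(_ q Vq)]].
split.
- exists setT; first exact: zopen_inT.
  by split=> //; exists p.
- move=> D E [_ [B cB ->] [[q [Zq [_ Bq]]] VD]].
  move=> [_ [C cC ->] [[r [Zr [_ Cr]]] WE]].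
  exists (~` (B `|` C)).
    by exists (B `|` C); [exact: zclosedU|rewrite setTD].
  split.
    apply: contrapT => /set0P/negP; rewrite negbK => /eqP h.
    have ZBC : Z `<=` B `|` C.
      move=> x Zx; apply: contrapT => nx.
      by have : (Z `&` ~` (B `|` C)) x by []; rewrite h.
    by have [/(_ q Zq)|/(_ r Zr)] := Zirr B C cB cC ZBC.
  move=> x [Zx /not_orP[nB nC]]; split; [exact: VD|exact: WE].
- move=> D E DE [V oV [V0 VD]]; exists V => //; split=> //.
  exact: subset_trans DE.
Qed.

Lemma generic_self Z : zirreducible Z -> generic Z Z.
Proof.
move=> [[p Zp] _]; exists setT; first exact: zopen_inT.
by split=> [|q []//]; exists p.
Qed.

Lemma regular_neq0 U (f : fn K n) p : regular U f -> U p -> f p != 0 ->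
  exists V, [/\ zopen_in setT V, V p & forall q, V q -> U q -> f q != 0].
Proof.
move=> rf Up; have [N [oN Np] [d [a [b [ad bd ab]]]]] := rf p Up.
have [b0 ->] := ab p Np Up; rewrite mulf_eq0 negb_or => /andP[ap _].
exists (N `&` ~` [set q | peval a q = 0]); split.
- apply: zopen_inI => //; exists [set q | peval a q = 0]; last by rewrite setTD.
  exact: zclosed_zero ad.
- by split=> //; exact/eqP.
- move=> q [Nq aq] Uq; have [bq ->] := ab q Nq Uq.
  by rewrite mulf_neq0 ?invr_eq0 //; exact/eqP.
Qed.

End Zariski.

(** * Values of sections of line bundles *)

Section Sections.
Context {K : fieldType} {n : nat} {X : set (pspace K n)}.
Implicit Types (E L : line_bundle X) (Z : set (pspace K n)).

Lemma H0_outside L s i p : H0 L s -> ~ (X `&` lb_open i) p -> s i p = 0.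
Proof. by move=> /asboolP[/(_ i)/asboolP[_ s0] _]; exact: s0. Qed.

Lemma section_neq0_generic L s Z i p : Z `<=` X -> H0 L s -> Z p ->
  s i p != 0 -> generic Z [set q | forall j, lb_open j q -> s j q != 0].
Proof.
move=> ZX sL Zp sip; have Xip : (X `&` lb_open i) p.
  by apply: contrapT => /(H0_outside sL)/eqP; exact/negP.
have /asboolP[/(_ i)/asboolP[rs _] sE] := sL.
have [V [oV Vp Vneq]] := regular_neq0 rs Xip sip.
have [N oN NE] := zopen_in_trace (lb_openP i).
exists (V `&` N); first exact: zopen_inI.
have [_ Np] : (X `&` N) p by rewrite -NE; case: Xip.
split=> [|q [Zq [Vq Nq]] j jq]; first by exists p.
have iq : lb_open i q by rewrite NE; split=> //; exact: ZX.
have : s i q != 0 by apply: Vneq => //; split=> //; exact: ZX.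
by rewrite (sE i j) //; [rewrite mulf_eq0 negb_or => /andP[]|exact: ZX].
Qed.

Lemma lb_coverP L p : X p -> exists i : lb_idx L, lb_open i p.
Proof. by rewrite {1}(lb_cover L) => -[i _ ip]; exists i. Qed.

(** The value at [p] in a trivialization around [p] that depends on [p] only, so
    that [value_at] is linear in [s].  Another trivialization would change it by
    a nonzero factor. *)
Definition value_at L (s : lb_idx L -> fn K n) (p : pspace K n) : K :=
  if pselect (exists i, lb_open i p) is left h then s (projT1 (cid h)) p else 0.

Lemma value_atP L p : X p ->
  exists2 i, lb_open i p & forall s, value_at (L := L) s p = s i p.
Proof.
move=> /(lb_coverP L) Lp; rewrite /value_at; case: pselect => // h.
by exists (projT1 (cid h)) => //; case: (cid h).
Qed.

Definition value_row L d (f : 'I_d -> lb_idx L -> fn K n) p : 'rV[K]_d :=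
  \row_k value_at (f k) p.

(** A nontrivial combination of the basis is a nonzero section, and a section
    that is nonzero at one point of [Z] is nonzero generically. *)
Lemma basis_nondegenerate L (H : set (lb_idx L -> fn K n)) Z d
    (f : 'I_d -> lb_idx L -> fn K n) :
  Z `<=` X -> zirreducible Z -> H `<=` H0 L -> is_basis (restr Z @` H) f ->
  nondegenerate (generic Z) (value_row f).
Proof.
move=> ZX Zirr HL [ffree fspan] c c0.
have Fg := generic_proper Zirr.
have [s Hs sE] : (restr Z @` H) (\sum_k c k 0 *: f k).
  by rewrite fspan; exists (c ^~ 0).
have [i [p sip]] : exists i p, restr Z s i p != 0.
  apply: contrapT => /forallNP h; move/eqP: c0; apply.
  apply/colP => k; rewrite mxE; apply: ffree (c ^~ 0) _ k.
  rewrite -sE; apply/funext => i; apply/funext => p.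
  by have /forallNP/(_ p)/negP := h i; rewrite negbK => /eqP.
have Zp : Z p.
  by apply: contrapT => nZ; move: sip; rewrite /restr cutoff_out ?eqxx.
move: sip; rewrite /restr cutoff_in // => sip.
have := section_neq0_generic ZX (HL _ Hs) Zp sip.
move=> /(filterI (generic_self Zirr)); apply: filterS => q [Zq] /= sq.
have [j jq jE] := value_atP L (ZX _ Zq).
apply/eqP => /matrixP/(_ 0 0); rewrite !mxE => e; move/eqP: (sq j jq); apply.
rewrite -(cutoff_in (U := Z)) // -[LHS]/(restr Z s j q) sE -{}[RHS]e.
rewrite !fct_sumE; apply: eq_bigr => k _.
by rewrite mxE jE mulrC.
Qed.

(** The transition functions of [twist E L 0] are those of [E], over the common
    refinement of the covers of [E] and [L]; so [s (i, j)] is the restriction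
    of one section over the [i]-th open set of [E], whatever [j] is. *)
Lemma H0_untwist E L s : H0 (twist E L 0) s ->
  exists2 u, H0 E u &
    forall i j p, lb_open i p -> lb_open j p -> u i p = s (i, j) p.
Proof.
move=> sH; have /asboolP[rs sE] := sH.
pose u i p : K^o := if pselect (exists j : lb_idx L, lb_open j p) is left h
  then s (i, projT1 (cid h)) p else 0.
have uE i j p : lb_open i p -> lb_open j p -> u i p = s (i, j) p.
  move=> ip jp; rewrite /u; case: pselect => [h|[]]; last by exists j.
  case: (cid h) => k kp /=.
  rewrite (sE (i, k) (i, j)) //= ?expr0z ?lb_trans1 ?mulr1 ?mul1r //.
  exact: zopen_in_sub (lb_openP i) _ ip.
exists u => //; apply/asboolP; split=> [i|i j p Xp ip jp]; last first.
  have [k kp] := lb_coverP L Xp.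
  by rewrite !(uE _ k) // (sE (i, k) (j, k)) //= expr0z mulr1.
apply/asboolP; split=> [p [Xp ip]|p nip].
  have [j jp] := lb_coverP L Xp.
  have [N' oN' NE] := zopen_in_trace (lb_openP j).
  have /asboolP[/(_ p (conj Xp (conj ip jp)))] := rs (i, j).
  move=> [N [oN Np] [d [a [b [ad bd ab]]]]] _.
  exists (N `&` N').
    by split; [exact: zopen_inI|split=> //; move: jp; rewrite NE => -[]].
  exists d, a, b; split=> // q [Nq N'q] [Xq iq].
  have jq : lb_open j q by rewrite NE.
  by rewrite (uE i j) //; exact: ab.
rewrite /u; case: pselect => // h; case: (cid h) => j jp /=.
by apply: H0_outside sH _ => -[Xp [ip _]]; exact: nip.
Qed.

End Sections.

(** * Bases of subspaces *)

Section Bases.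
Context {K : fieldType} {V : lmodType K} {S : set V}.

Lemma span_coords d (e : 'I_d -> V) v :
  is_basis S e -> S v -> exists c : 'rV[K]_d, v = \sum_k c 0 k *: e k.
Proof.
move=> [_ ->] [c ->]; exists (\row_k c k).
by apply: eq_bigr => k _; rewrite mxE.
Qed.

Lemma basis_mem d (e : 'I_d -> V) k : is_basis S e -> S (e k).
Proof.
move=> [_ ->]; exists (fun j => (j == k)%:R).
by rewrite (bigD1 k) //= eqxx scale1r big1 ?addr0 // => j /negPf ->;
  rewrite scale0r.
Qed.

Lemma basis_card_le d d' (e : 'I_d -> V) (e' : 'I_d' -> V) :
  is_basis S e -> is_basis S e' -> (d' <= d)%N.
Proof.
move=> eS e'S; have [e'free _] := e'S.
have /choice[A AE] i : exists c : 'rV[K]_d, e' i = \sum_j c 0 j *: e j.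
  exact: span_coords (basis_mem i e'S).
have : row_free (\matrix_i A i).
  apply: inj_row_free => v vA; apply/rowP => i; rewrite mxE.
  apply: e'free (v 0) _ i; under eq_bigr do rewrite AE scaler_sumr.
  rewrite exchange_big big1 //= => j _.
  under eq_bigr do rewrite scalerA.
  rewrite -scaler_suml -[RHS](scale0r (e j)); congr (_ *: _).
  have /rowP/(_ j) := vA; rewrite !mxE => vAj; rewrite -[RHS]vAj.
  by apply: eq_bigr => k _; rewrite mxE.
by rewrite /row_free => /eqP <-; exact: rank_leq_col.
Qed.

End Bases.

(** * Koszul cycles *)

Section Vanishing.
Context {K : fieldType} {n : nat} {X : set (pspace K n)}.
Context (omega L : line_bundle X).

(** Points that impose independent conditions on the restriction of [W] to [Z]
    impose independent conditions on [W]: on points of [Z], values of the [f k]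
    are linear combinations of values of the [w l]. *)
Lemma row_free_restriction (W : set (lb_idx L -> fn K n)) Z m d N
    (w : 'I_m -> lb_idx L -> fn K n) (f : 'I_d -> lb_idx L -> fn K n)
    (x : 'I_N -> pspace K n) :
  Z `<=` X -> is_basis W w -> is_basis (restr Z @` W) f ->
  (forall i, Z (x i)) ->
  row_free (\matrix_i value_row f (x i)) ->
  row_free (\matrix_i value_row w (x i)).
Proof.
move=> ZX wW fW Zx.
have /choice[B fB] k : exists b : 'rV[K]_m, f k = restr Z (\sum_l b 0 l *: w l).
  have [s Ws <-] := basis_mem k fW.
  by have [b ->] := span_coords wW Ws; exists b.
have -> : \matrix_i value_row f (x i) =
    (\matrix_i value_row w (x i)) *m (\matrix_k B k)^T.
  apply/matrixP => i k; rewrite !mxE.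
  have [j ij jE] := value_atP L (ZX _ (Zx i)).
  rewrite jE fB /restr cutoff_in // !fct_sumE; apply: eq_bigr => l _.
  by rewrite !mxE jE mulrC.
rewrite /row_free => /eqP rk; rewrite eqn_leq rank_leq_row /=.
by rewrite -{1}rk mxrankM_maxl.
Qed.

(** The coefficients of [a], restricted to [Z], have coordinates in the basis
    [h] of the restrictions of sections of [omega]; in these terms the cycle
    condition at a point of [Z] is the hypothesis of [contr_general_position]. *)
Lemma cycle_zero_on_component (W : set (lb_idx L -> fn K n)) Z m d g t
    (w : 'I_m -> lb_idx L -> fn K n)
    (a : {set 'I_m} -> lb_idx omega * lb_idx L -> fn K n) :
  Z `<=` X -> zirreducible Z -> W `<=` H0 L -> is_basis W w ->
  has_dim (restr Z @` W) d -> has_dim (restr Z @` H0 omega) g ->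
  (g + m <= t + d)%N ->
  (forall S : {set 'I_m}, #|S| = t -> H0 (twist omega L 0) (a S)) ->
  (forall S : {set 'I_m}, #|S| <> t -> a S = 0) ->
  koszul_d w a = 0 ->
  forall S i j p, Z p -> lb_open i p -> lb_open j p -> a S (i, j) p = 0.
Proof.
move=> ZX Zirr WL wW [f fW] [h hH] gt aH a0 da.
have Zgen := generic_proper Zirr.
(* With exactly [d] points, general position of the rows of values of [f] means
   that these rows form a basis. *)
have [x [Zx xf xh]] := exists_general_position d (generic_self Zirr)
  (basis_nondegenerate ZX Zirr WL fW)
  (basis_nondegenerate ZX Zirr (@subset_refl _ _) hH).
have wfree : row_free (\matrix_i value_row w (x i)).
  apply: (row_free_restriction ZX wW fW Zx).
  rewrite /row_free -mxrank_tr; apply: inj_row_free => u uf.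
  apply: (xf finset.setT u) => [|i _]; first by rewrite cardsT card_ord.
  apply/colP => k; rewrite ord1 mxE.
  have /rowP/(_ i) := uf; rewrite !mxE => ufi; rewrite -[RHS]ufi.
  by apply: eq_bigr => l _; rewrite !mxE.
have /choice[c cE] (S : {set 'I_m}) : exists c : 'rV[K]_g, forall i j p,
    Z p -> lb_open i p -> lb_open j p -> a S (i, j) p = \sum_k c 0 k * h k i p.
  have [St|St] := eqVneq #|S| t; last first.
    exists 0 => i j p _ _ _; rewrite a0; last exact/eqP.
    by rewrite big1 // => k _; rewrite mxE mul0r.
  have [u uH uE] := H0_untwist (aH S St).
  have [c uc] : exists c : 'rV[K]_g, restr Z u = \sum_k c 0 k *: h k.
    by apply: (span_coords hH); exists u.
  exists c => i j p Zp ip jp; rewrite -uE // -(cutoff_in (U := Z) (u i)) //.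
  by rewrite -[LHS]/(restr Z u i p) uc !fct_sumE.
suff c0 (S : {set 'I_m}) : #|S| = t -> c S = 0.
  move=> S i j p Zp ip jp.
  have [St|/eqP St] := eqVneq #|S| t; last by rewrite a0.
  by rewrite cE // c0 // big1 // => k _; rewrite mxE mul0r.
apply: (contr_general_position wfree xh _ gt) => i T.
have [j ij jE] := value_atP omega (ZX _ (Zx i)).
have [l il lE] := value_atP L (ZX _ (Zx i)).
apply/matrixP => r s; rewrite !ord1 {r s} summxE mxE.
transitivity (koszul_d w a T (j, l) (x i)); last by rewrite da.
apply: eq_bigr => k _; rewrite /= cE // !mxE lE mulrA; congr (_ * _).
by apply: eq_bigr => q _; rewrite !mxE jE.
Qed.

Lemma koszul_vanishing (W : set (lb_idx L -> fn K n)) (m : nat)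
    (mZ gZX : set (pspace K n) -> nat) (t : int) :
  zclosed X -> W `<=` H0 L -> has_dim W m ->
  (forall Z, component X Z -> has_dim (restr Z @` W) (mZ Z)) ->
  (forall Z, component X Z -> has_dim (restr Z @` H0 omega) (gZX Z)) ->
  (forall Z, component X Z -> (gZX Z)%:Z - (mZ Z)%:Z + m%:Z <= t) ->
  koszul_cohomology_zero omega L W t 0.
Proof.
move=> cX WL [e eW] mW gH bound m' w wW a aH da.
suff a0 : a = 0.
  exists 0 => [S|]; last first.
    rewrite a0; apply/funext => T; apply/funext => i; apply/funext => p.
    by rewrite /koszul_d big1 // => k _; rewrite !mulr0.
  by case: ifP => // _; exact: (rpred0 (secpred (twist omega L (0 - 1)) X)).
apply/funext => S; apply/funext => -[i j]; apply/funext => p.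
have := aH S; case: eqP => [St aSH|_ -> //].
have [[Xp [ip jp]]|out] :=
  pselect ((X `&` (lb_open i `&` lb_open j)) p); last first.
  by rewrite (H0_outside (L := twist omega L 0) (i := (i, j)) aSH out).
have [Z Zc Zp] := exists_component cX Xp; have [_ Zirr ZX _] := Zc.
(* The complex is written in an arbitrary basis [w] of [W], unrelated to [e]. *)
have m'm := basis_card_le eW wW.
apply: (cycle_zero_on_component (t := #|S|) ZX Zirr WL wW (mW Z Zc) (gH Z Zc))
  => //.
- have := bound Z Zc; rewrite -St addrAC lerBlDr -!PoszD lez_nat.
  by apply: leq_trans; rewrite leq_add2l.
- by move=> T TS; have := aH T; rewrite TS St eqxx.
- by move=> T TS; have := aH T; rewrite -St eqz_nat; case: eqP.
Qed.

End Vanishing.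

Theorem theorem4 (R : realType) (n : nat) (X : set (pspace R[i] n))
    (omega L : line_bundle X) (W : set (lb_idx L -> fn R[i] n)) (m : nat)
    (mZ gZX : set (pspace R[i] n) -> nat) (t : int) :
  deeply_lci_curve X ->
  dualizing_sheaf (lb_sheaf omega) ->
  W `<=` H0 L ->
  has_dim W m ->
  (forall Z, component X Z -> has_dim (restr Z @` W) (mZ Z)) ->
  (forall Z, component X Z -> has_dim (restr Z @` H0 omega) (gZX Z)) ->
  (forall Z, component X Z -> (gZX Z)%:Z - (mZ Z)%:Z + m%:Z <= t) ->
  koszul_cohomology_zero omega L W t 0.
Proof. by move=> [[cX _ _] _] _; exact: koszul_vanishing. Qed.
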